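(* Let $\psi_1:(0,\infty)\to(0,\infty)$ be a measurable function, let $Z_1^*=S_1/S_2$, and consider the estimator $\delta_{\psi_1}=\psi_1(Z_1^* )S_2$ of $\sigma_2^2$. Put $$\psi_{11}^{Q}(z_1^* )=\frac{1+z_1^*}{m_1+m_2+2}\,\frac{E(\tau^{-1})}{E(\tau^{-2})}.$$ If $P\left(\psi_{11}^{Q}(Z_1^* )>\psi_1(Z_1^* )\right)>0$, then under the squared error loss $L_1$ the estimator $$\delta_{S1}^{Q*}=\max\left\{\psi_1(Z_1^* ),\psi_{11}^{Q}(Z_1^* )\right\}S_2$$ has uniformly smaller risk than $\delta_{\psi_1}$.
   Context: Model: $p,q,m_1,m_2$ are positive integers; $\tau$ is a positive random variable (mixing variable) with known distribution $\Pi$ on $(0,\infty)$, such that the moments $E(\tau^{-1})$ and $E(\tau^{-2})$ are finite. Conditionally on $\tau$, the variables $\boldsymbol X_1,S_1,\boldsymbol X_2,S_2$ are independent with $\boldsymbol X_1\sim N_p(\boldsymbol\theta_1,\frac{\sigma_1^2}{\tau}I)$, $S_1\sim\frac{\sigma_1^2}{\tau}\chi^2_{m_1}$, $\boldsymbol X_2\sim N_q(\boldsymbol\theta_2,\frac{\sigma_2^2}{\tau}I)$, $S_2\sim\frac{\sigma_2^2}{\tau}\chi^2_{m_2}$ (the same $\tau$ for all four). The unknown parameters are $\boldsymbol\theta_1\in\mathbb R^p$, $\boldsymbol\theta_2\in\mathbb R^q$, $\sigma_1,\sigma_2>0$ with the order restriction $\sigma_1\le\sigma_2$. The squared error loss for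 estimating $\sigma^2$ by $\delta$ is $L_1(\delta,\sigma^2)=(\delta/\sigma^2-1)^2$; the risk of an estimator $\delta$ of $\sigma_2^2$ is $R(\delta)=E[L_1(\delta,\sigma_2^2)]$, a function of the parameters. The estimators to be improved are understood to have finite risk. $\delta'$ has uniformly smaller risk than $\delta$ if $R(\delta')<R(\delta)$ for all admissible parameter values. *)

(* Defs.v *)
From HB Require Import structures.
From mathcomp Require Import all_boot all_order all_algebra.
From mathcomp Require Import all_classical all_reals all_analysis.

Set Implicit Arguments.
Unset Strict Implicit.
Unset Printing Implicit Defensive.

Import Order.TTheory GRing.Theory Num.Theory.
Import numFieldNormedType.Exports.

Local Open Scope classical_set_scope.
Local Open Scope ring_scope.

(* N_n(theta, s^2 I): the product of the measures N(theta_i, s^2), as an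
   iterated integral.  The parameter s is the standard deviation, as in
   normal_prob. *)
Fixpoint normal_iso (R : realType) (n : nat) :
    n.-tuple R -> R -> set (n.-tuple R) -> \bar R :=
  match n with
  | 0 => fun _ _ A => (\1_A [tuple])%:E
  | n'.+1 => fun theta s A =>
      (\int[normal_prob (thead theta) s]_x
         normal_iso [tuple of behead theta] s
           [set y : n'.-tuple R | A [tuple of x :: y]])%E
  end.

Definition Gamma_fun (R : realType) (a : R) : R :=
  \int[@lebesgue_measure R]_(x in `]0, +oo[) (x `^ (a - 1) * expR (- x)).

Definition chi2_pdf (R : realType) (m : nat) (x : R) : R :=
  if 0 < x then
    x `^ (m%:R / 2 - 1) * expR (- (x / 2))
      / (2 `^ (m%:R / 2) * Gamma_fun (m%:R / 2))
  else 0.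

Definition chi2_prob (R : realType) (m : nat) (A : set R) : \bar R :=
  (\int[@lebesgue_measure R]_(x in A) (chi2_pdf m x)%:E)%E.

(* The law of c * Y for Y distributed as chi^2_m. *)
Definition scaled_chi2 (R : realType) (m : nat) (c : R) (A : set R) : \bar R :=
  chi2_prob m [set x | A (c * x)].

Record param (R : realType) (p q : nat) := Param {
  theta1 : p.-tuple R;
  theta2 : q.-tuple R;
  sigma1 : R;
  sigma2 : R }.

Definition admissible (R : realType) (p q : nat) (par : param R p q) : Prop :=
  [/\ 0 < sigma1 par, 0 < sigma2 par & sigma1 par <= sigma2 par].

(* The sample space and the random variables are fixed, and the probability
   measure P par varies with the parameter.  The last field says at once that
   tau has law Pi (take A1, B1, A2, B2 full), that X1, S1, X2, S2 are
   conditionally independent given tau (the integrand is a product), and that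
   their conditional laws given tau = t are the stated ones; these are the
   defining properties of regular conditional laws given tau. *)
Record mixture_model (R : realType) (d : measure_display)
    (Omega : measurableType d) (p q m1 m2 : nat) (Pi : probability R R)
    (P : param R p q -> probability Omega R) (tau : {mfun Omega >-> R})
    (X1 : {mfun Omega >-> p.-tuple R}) (S1 : {mfun Omega >-> R})
    (X2 : {mfun Omega >-> q.-tuple R}) (S2 : {mfun Omega >-> R}) : Prop :=
  MixtureModel {
    mixing_support : Pi [set t | 0 < t] = 1%E;
    tau_gt0 : forall w, 0 < tau w;
    S1_gt0 : forall w, 0 < S1 w;
    S2_gt0 : forall w, 0 < S2 w;
    joint_law : forall par : param R p q, admissible par ->
      forall (T : set R) (A1 : set (p.-tuple R)) (B1 : set R)
             (A2 : set (q.-tuple R)) (B2 : set R),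
      measurable T -> measurable A1 -> measurable B1 ->
      measurable A2 -> measurable B2 ->
      P par (tau @^-1` T `&` X1 @^-1` A1 `&` S1 @^-1` B1
             `&` X2 @^-1` A2 `&` S2 @^-1` B2) =
      (\int[Pi]_(t in T `&` [set t | (0 < t)%R])
         (normal_iso (theta1 par) (sigma1 par / Num.sqrt t)%R A1
          * scaled_chi2 m1 (sigma1 par ^+ 2 / t)%R B1
          * normal_iso (theta2 par) (sigma2 par / Num.sqrt t)%R A2
          * scaled_chi2 m2 (sigma2 par ^+ 2 / t)%R B2))%E }.

(* E(tau^-k), computed under the law Pi of tau. *)
Definition inv_moment (R : realType) (Pi : probability R R) (k : nat) : \bar R :=
  'E_Pi[fun t : R => t ^- k]%E.

Definition L1 (R : realType) (delta s2 : R) : R := (delta / s2 - 1) ^+ 2.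

Definition risk (R : realType) (d : measure_display) (Omega : measurableType d)
    (p q : nat) (P : param R p q -> probability Omega R) (delta : Omega -> R)
    (par : param R p q) : \bar R :=
  'E_(P par)[fun w => L1 (delta w) (sigma2 par ^+ 2)]%E.

Definition uniformly_smaller_risk (R : realType) (d : measure_display)
    (Omega : measurableType d) (p q : nat)
    (P : param R p q -> probability Omega R) (delta' delta : Omega -> R) : Prop :=
  forall par : param R p q, admissible par ->
    (risk P delta' par < risk P delta par)%E.

Definition Z1star (R : realType) (Omega : Type) (S1 S2 : Omega -> R) : Omega -> R :=
  fun w => S1 w / S2 w.

Definition scale_estimator (R : realType) (Omega : Type) (psi : R -> R)
    (S1 S2 : Omega -> R) : Omega -> R :=
  fun w => psi (Z1star S1 S2 w) * S2 w.

Definition psi11Q (R : realType) (Pi : probability R R) (m1 m2 : nat) (z : R) : R :=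
  (1 + z) / (m1 + m2 + 2)%:R * (fine (inv_moment Pi 1) / fine (inv_moment Pi 2)).

(* Main.v *)
(* Write rho = sigma1^2 / sigma2^2 <= 1.  In the variables z = S1 / S2, t = tau
   and y = tau S2 / sigma2^2, the model has a density with respect to
   Lebesgue \x Pi \x Lebesgue, and S2 / sigma2^2 = y / t, so the risk of
   psi(Z) S2 is the integral over z of
     Phi(z, c) = int (c y / t - 1)^2 density(z, t, y),   c = psi(z).
   For fixed z > 0 the density in y is a multiple of the Gamma kernel
   y^((m1 + m2) / 2 - 1) exp (- (1 + z / rho) y / 2), so Phi(z, .) is a quadratic
   polynomial minimal at
     (1 + z / rho) / (m1 + m2 + 2) * E(1 / tau) / E(1 / tau^2) >= psi11Q(z).
   Raising psi(z) to psi11Q(z) therefore lowers Phi(z, .) strictly wherever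
   psi(z) < psi11Q(z), and the set of these z does not depend on the parameter:
   it has positive Lebesgue measure as soon as it is charged for one parameter. *)

Require Import Defs.
From HB Require Import structures.
From mathcomp Require Import all_boot all_order all_algebra.
From mathcomp Require Import all_classical all_reals all_analysis.
From mathcomp Require Import measurable_realfun ring.

Set Implicit Arguments.
Unset Strict Implicit.
Unset Printing Implicit Defensive.

Import Order.TTheory GRing.Theory Num.Theory.
Import numFieldNormedType.Exports.

Local Open Scope classical_set_scope.
Local Open Scope ring_scope.

(** * Densities and changes of variables *)

Section density.
Local Open Scope ereal_scope.
Context (d : measure_display) (T : measurableType d) (R : realType).
Variables (mu : {measure set T -> \bar R}) (f : T -> R).
Hypotheses (f_ge0 : forall x, (0 <= f x)%R) (mf : measurable_fun setT f).

(** The two proofs are arguments so that the measure structure declared below can be inferred from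
    the term itself. *)
Definition mdensity of (forall x, (0 <= f x)%R) & measurable_fun setT f :=
  fun A : set T => \int[mu]_(x in A) (f x)%:E.

Local Notation nu := (mdensity f_ge0 mf).

Let mdensity0 : nu set0 = 0.
Proof. exact: integral_set0. Qed.

Let mdensity_ge0 A : 0 <= nu A.
Proof. by apply: integral_ge0 => x _; rewrite lee_fin. Qed.

Let mdensity_sigma_additive : semi_sigma_additive nu.
Proof.
move=> F mF tF mUF; rewrite /mdensity; apply: cvg_toP.
  apply: ereal_nondecreasing_is_cvgn => m n mn.
  apply: lee_sum_nneg_natr => // k _ _.
  by apply: integral_ge0 => x _; rewrite lee_fin.
rewrite ge0_integral_bigcup//=.
  by apply/measurable_EFinP; exact: measurable_funTS.
by move=> x _; rewrite lee_fin.
Qed.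

HB.instance Definition _ := isMeasure.Build _ _ _ nu
  mdensity0 mdensity_ge0 mdensity_sigma_additive.

Import HBNNSimple.

(** Monotone convergence along simple functions, on both sides, reduces the identity to indicators,
    where it is the definition of [mdensity]. *)
Lemma ge0_integral_mdensity (h : T -> \bar R) : measurable_fun setT h ->
  (forall x, 0 <= h x) ->
  \int[nu]_x h x = \int[mu]_x (h x * (f x)%:E).
Proof.
move=> mh h0; pose h_ := nnsfun_approx measurableT mh.
transitivity (limn (fun n => \int[nu]_x (h_ n x)%:E)).
  rewrite -monotone_convergence//=.
  - apply: eq_integral => x _; apply/esym/cvg_lim => //=.
    exact: cvg_nnsfun_approx.
  - by move=> n; exact/measurable_EFinP/measurable_funTS.
  - by move=> n x _; rewrite lee_fin.
  - by move=> x _ m n mn; rewrite lee_fin; exact/lefP/nd_nnsfun_approx.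
transitivity (limn (fun n => \int[mu]_x ((h_ n x)%:E * (f x)%:E))); last first.
  rewrite -monotone_convergence//=.
  - apply: eq_integral => x _; apply/cvg_lim => //=.
    apply: cvgeZr => //; exact: cvg_nnsfun_approx.
  - by move=> n; apply/measurable_EFinP/measurable_funM.
  - by move=> n x _; rewrite mule_ge0 ?lee_fin.
  - move=> x _ m n mn; rewrite lee_wpmul2r ?lee_fin//.
    exact/lefP/nd_nnsfun_approx.
congr (limn _); apply/funext => n.
have hE x : (h_ n x)%:E =
    \sum_(k \in range (h_ n)) (k * \1_(h_ n @^-1` [set k]) x)%:E.
  by rewrite {1}fimfunE -fsumEFin.
have fE x : (h_ n x)%:E * (f x)%:E =
    \sum_(k \in range (h_ n)) (k * \1_(h_ n @^-1` [set k]) x)%:E * (f x)%:E.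
  rewrite hE muleC ge0_mule_fsumr.
    by apply: eq_fsbigr => k _; rewrite muleC.
  by move=> k; rewrite nnfun_muleindic_ge0.
rewrite [RHS](eq_integral _ _ (fun x _ => fE x)).
rewrite (eq_integral _ _ (fun x _ => hE x)).
rewrite ge0_integral_fsum//; last 2 first.
- by move=> y; exact/measurable_EFinP/measurable_funM.
- by move=> y x _; rewrite nnfun_muleindic_ge0.
rewrite ge0_integral_fsum//; last 2 first.
- by move=> y; apply/measurable_EFinP/measurable_funM => //; exact: measurable_funM.
- by move=> y x _; rewrite mule_ge0 ?nnfun_muleindic_ge0 ?lee_fin.
apply: eq_fsbigr => r /[!inE] -[x _ <-].
rewrite integralZl_indic_nnsfun// integral_indic//=.
under [RHS]eq_integral do rewrite EFinM -muleA.
rewrite ge0_integralZl//; last 3 first.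
- by apply/measurable_EFinP/measurable_funM.
- by move=> y _; rewrite mule_ge0 ?lee_fin.
- by rewrite lee_fin.
congr (_ * _); rewrite /mdensity setIT [LHS]integral_mkcond.
by apply: eq_integral => y _; rewrite patchE indicE; case: (y \in _); rewrite ?mul1e ?mul0e.
Qed.

End density.

Section lebesgue_scaling.
Local Open Scope ereal_scope.
Context {R : realType}.
Local Notation mu := (@lebesgue_measure R).

(** Uniqueness of Lebesgue measure: [c] times the image of [mu] under multiplication by [c] gives
    each half-open interval its length. *)
Lemma lebesgue_measure_scale (c : R) (A : set R) : (0 < c)%R -> measurable A ->
  mu A = c%:E * mu [set x | A (c * x)%R].
Proof.
move=> c0 mA.
have mc : measurable_fun [set: measurableTypeR R]
    ( *%R c : measurableTypeR R -> measurableTypeR R).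
  exact: mulrl_measurable.
pose f : {mfun measurableTypeR R >-> measurableTypeR R} :=
  HB.pack ( *%R c) (isMeasurableFun.Build _ _ _ _ _ mc).
have -> := @lebesgue_measure_unique R (mscale (NngNum (ltW c0)) (pushforward mu f)) _ A mA.
  by [].
move=> X [[a b]] _ <-.
transitivity (c%:E * mu `](a / c)%R, (b / c)%R]); last first.
  congr (_ * mu _); apply/seteqP; split => x /=;
  by rewrite !in_itv/= ltr_pdivrMr// ler_pdivlMr// (mulrC x).
rewrite !lebesgue_measure_itv/= !lte_fin ltr_pM2r ?invr_gt0//.
case: ifPn => _; last by rewrite mule0.
by rewrite -!EFinB -EFinM -mulrBl mulrCA divff ?gt_eqF// mulr1.
Qed.

Lemma ge0_integral_scale (c : R) (f : R -> \bar R) : (0 < c)%R ->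
  measurable_fun setT f -> (forall x, 0 <= f x) ->
  \int[mu]_x f x = \int[mu]_x (c%:E * f (c * x)%R).
Proof.
move=> c0 mf f0.
have mc : measurable_fun [set: measurableTypeR R]
    ( *%R c : measurableTypeR R -> measurableTypeR R).
  exact: mulrl_measurable.
pose g : {mfun measurableTypeR R >-> measurableTypeR R} :=
  HB.pack ( *%R c) (isMeasurableFun.Build _ _ _ _ _ mc).
rewrite ge0_integralZl//; last 2 first.
- exact: measurableT_comp.
- by rewrite lee_fin ltW.
rewrite [LHS](eq_measure_integral (mscale (NngNum (ltW c0)) (pushforward mu g))).
  rewrite ge0_integral_mscale//; congr (_ * _).
  by rewrite ge0_integral_pushforward.
by move=> A mA _; exact: lebesgue_measure_scale.
Qed.

End lebesgue_scaling.

(** * Strict comparison of integrals *)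

Section strict_integral.
Local Open Scope ereal_scope.
Context (d : measure_display) (T : measurableType d) (R : realType).
Variable mu : {measure set T -> \bar R}.

(** A zero integral would make [f] vanish almost everywhere on [D], so that [D] would lie in a null
    set. *)
Lemma integral_gt0 (D : set T) (f : T -> \bar R) : measurable D ->
  measurable_fun D f -> (forall x, D x -> 0 < f x) -> 0 < mu D ->
  0 < \int[mu]_(x in D) f x.
Proof.
move=> mD mf f0 D0.
have fge0 x : D x -> 0 <= f x by move=> /f0/ltW.
rewrite lt0e integral_ge0// andbT; apply/eqP => I0.
have : \int[mu]_(x in D) `|f x| = 0.
  by rewrite -[RHS]I0; apply: eq_integral => x /[!inE] Dx; rewrite gee0_abs ?fge0.
move/ae_eq_integral_abs => /(_ mD mf) /= [N [mN N0 DN]].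
suff : mu D <= mu N by rewrite N0 leNgt D0.
apply: le_measure; rewrite ?inE// => x Dx; apply: DN => /= /(_ Dx) fx0.
by have := f0 _ Dx; rewrite fx0 ltxx.
Qed.

(** Write [g] as [f + (g - f)], which is legitimate since [g] has finite values. The second integral
    is positive because of [D], and adding it to the finite integral of [f] is a strict increase. *)
Lemma lt_ge0_integral (D : set T) (f g : T -> \bar R) : measurable D ->
  measurable_fun setT f -> measurable_fun setT g ->
  (forall x, 0 <= f x) -> (forall x, f x <= g x) ->
  (forall x, g x \is a fin_num) -> (forall x, D x -> f x < g x) ->
  0 < mu D -> \int[mu]_x g x < +oo -> \int[mu]_x f x < \int[mu]_x g x.
Proof.
move=> mD mf mg f0 fg gfin fgD D0 goo.
have ffin x : f x \is a fin_num.
  by rewrite ge0_fin_numE// (le_lt_trans (fg x))// ltey_eq gfin.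
have gf0 x : 0 <= g x - f x by rewrite sube_ge0// ?fg ?ffin ?orbT.
have mgf : measurable_fun setT (fun x => g x - f x) by exact: emeasurable_funB.
have -> : \int[mu]_x g x = \int[mu]_x f x + \int[mu]_x (g x - f x).
  rewrite -ge0_integralD//; apply: eq_integral => x _.
  by rewrite addeC subeK.
have If : \int[mu]_x f x < +oo.
  by rewrite (le_lt_trans _ goo)// ge0_le_integral// => x _; rewrite (le_trans (f0 x)).
rewrite lteDl ?ge0_fin_numE ?integral_ge0//.
apply: (@lt_le_trans _ _ (\int[mu]_(x in D) (g x - f x))).
  apply: integral_gt0 => //; first exact: measurable_funTS.
  by move=> x Dx; rewrite sube_gt0 fgD.
by apply: ge0_subset_integral.
Qed.

End strict_integral.

(** * Products of sigma-finite measures *)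

Section sigma_finite_product.
Local Open Scope ereal_scope.
Context (d1 d2 : measure_display) (T1 : measurableType d1) (T2 : measurableType d2).
Context (R : realType).
Variables (m1 : {sigma_finite_measure set T1 -> \bar R}).
Variables (m2 : {sigma_finite_measure set T2 -> \bar R}).

(* On [m1 \x m2] itself the inferred sigma-finite structure is the one for
   products of subprobabilities, so the general one needs a name of its own. *)
Definition sigma_finite_prod : set (T1 * T2) -> \bar R := m1 \x m2.

HB.instance Definition _ := Measure.copy sigma_finite_prod (m1 \x m2).

(** The exhausting sequences of the factors are taken nondecreasing, so a point lying in [F n] and
    [G k] is caught by the product of index [maxn n k]. *)
Let sigma_finite_prodT : sigma_finite setT sigma_finite_prod.
Proof.
have /sigma_finiteP[F [TF ndF Foo]] := sigma_finiteT m1.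
have /sigma_finiteP[G [TG ndG Goo]] := sigma_finiteT m2.
exists (fun n => F n `*` G n).
  rewrite -setXTT TF TG; apply/seteqP; split => -[x y].
    move=> [/= [n _ Fnx] [k _ Gky]]; exists (maxn n k) => //; split.
    - by move: x Fnx; exact/subsetPset/ndF/leq_maxl.
    - by move: y Gky; exact/subsetPset/ndG/leq_maxr.
  by move=> [n _ []/= ? ?]; split; exists n.
move=> k; have [? ?] := Foo k; have [? ?] := Goo k.
split; first exact: measurableX.
by rewrite /sigma_finite_prod product_measure1E// lte_mul_pinfty// ge0_fin_numE.
Qed.

HB.instance Definition _ := Measure_isSigmaFinite.Build _ _ _ sigma_finite_prod
  sigma_finite_prodT.

End sigma_finite_product.

(** * Gamma integrals *)

Section gamma_kernel.
Context {R : realType}.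
Local Notation mu := (@lebesgue_measure R).
Implicit Types b s c y : R.

(** The Gamma density of shape [s + 1] and rate [b], without its normalising constant. *)
Definition gamma_kernel b s y := y `^ s * expR (- (b * y)).

Lemma gamma_kernel_ge0 b s y : 0 <= gamma_kernel b s y.
Proof. by rewrite mulr_ge0 ?powR_ge0 ?expR_ge0. Qed.

Lemma gamma_kernel_gt0 b s y : 0 < y -> 0 < gamma_kernel b s y.
Proof. by move=> y0; rewrite mulr_gt0 ?powR_gt0 ?expR_gt0. Qed.

Lemma measurable_gamma_kernel b s : measurable_fun setT (gamma_kernel b s).
Proof.
apply: measurable_funM => //; apply: measurableT_comp => //.
by apply: measurableT_comp => //; exact: measurable_funM.
Qed.

(** With [k = s / b], the inequality [y / k <= expR (y / k)] raised to the power [s] gives the bound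
    with [C = k ^ s]. *)
Lemma powR_le_expR b s : 0 < b -> 0 <= s ->
  exists2 C, 0 < C & forall y, 0 <= y -> y `^ s <= C * expR (b * y).
Proof.
move=> b0; rewrite le_eqVlt => /predU1P[<-|s0].
  exists 1 => // y y0; rewrite powRr0 mul1r.
  by rewrite -[leLHS]expR0 ler_expR mulr_ge0// ltW.
have k0 : 0 < s / b by rewrite divr_gt0.
exists ((s / b) `^ s); first by rewrite powR_gt0.
move=> y y0.
have -> : b * y = y / (s / b) * s by field; rewrite !gt_eqF.
rewrite expRM -powRM ?expR_ge0 ?(ltW k0)//.
apply: ge0_ler_powR; rewrite ?nnegrE ?(ltW s0)//.
  by rewrite mulr_ge0 ?expR_ge0 ?(ltW k0).
rewrite mulrC -ler_pdivrMr//.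
by rewrite (le_trans _ (expR_ge1Dx _))// lerDr.
Qed.

(** Half of the exponential decay absorbs the power; the other half remains as an integrable
    bound. *)
Lemma gamma_kernel_le_expR b s : 0 < b -> 0 <= s ->
  exists2 C, 0 < C & forall y, 0 <= y ->
    gamma_kernel b s y <= C * expR (- (b / 2 * y)).
Proof.
move=> b0 s0; have b20 : 0 < b / 2 by rewrite divr_gt0.
have [C C0 Cle] := powR_le_expR b20 s0; exists C => // y y0.
apply: (le_trans (ler_wpM2r (expR_ge0 _) (Cle _ y0))).
rewrite -[_ * _ * expR _]mulrA -expRD.
by have -> : b / 2 * y - b * y = - (b / 2 * y) by field.
Qed.

Lemma cvgy_expRN b : 0 < b -> expR (- (b * y)) @[y --> +oo] --> (0 : R).
Proof.
move=> b0; rewrite (_ : (fun y => expR (- (b * y))) =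
               (fun z => expR (- z)) \o (fun z => b * z))//.
apply: (@cvg_comp _ _ _ _ _ _ (pinfty_nbhs R)); last exact: cvgr_expR.
exact: gt0_cvgMry.
Qed.

Lemma cvgy_gamma_kernel b s : 0 < b -> 0 <= s ->
  gamma_kernel b s y @[y --> +oo] --> (0 : R).
Proof.
move=> b0 s0; have [C C0 Cle] := gamma_kernel_le_expR b0 s0.
have b20 : 0 < b / 2 by rewrite divr_gt0.
apply: (@squeeze_cvgr _ _ _ _ (cst 0) (fun y => C * expR (- (b / 2 * y)))).
- by near=> y; rewrite gamma_kernel_ge0/= Cle.
- exact: cvg_cst.
- by rewrite -[X in _ --> X](mulr0 C); apply: cvgMr; exact: cvgy_expRN.
Unshelve. all: by end_near. Qed.

Lemma continuous_expRNM b : continuous (fun y : R => expR (- (b * y))).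
Proof.
move=> z; apply: continuous_comp; last exact: continuous_expR.
by apply: continuousN; apply: continuousM => //; exact: cst_continuous.
Qed.

Lemma gamma_kernel_cvg0 b s : 0 < s -> gamma_kernel b s y @[y --> 0^'+] --> (0 : R).
Proof.
move=> s0; rewrite -[X in _ --> X](mul0r (expR (- (b * 0)))).
apply: cvgM; first exact: powR_cvg0.
exact/cvg_at_right_filter/continuous_expRNM.
Qed.

Lemma gamma_kernel0 b s : 0 < s -> gamma_kernel b s 0 = 0.
Proof. by move=> s0; rewrite /gamma_kernel powR0 ?mul0r// gt_eqF. Qed.

Lemma is_derive_gamma_kernel b s y : 0 < y ->
  is_derive y 1 (gamma_kernel b s) (s * gamma_kernel b (s - 1) y - b * gamma_kernel b s y).
Proof.
move=> y0; have := is_derive1_powR s y0 => dp.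
rewrite /gamma_kernel; apply: is_derive_eq.
rewrite /GRing.scale/=; ring.
Qed.

Lemma continuous_gamma_kernel b s y : 0 < y -> {for y, continuous (gamma_kernel b s)}.
Proof.
move=> y0; apply/differentiable_continuous/derivable1_diffP.
exact: (@ex_derive _ _ _ _ _ _ _ (is_derive_gamma_kernel b s y0)).
Qed.

Lemma integral_expRN b : 0 < b ->
  (\int[mu]_(y in `[0%R, +oo[) (expR (- (b * y)))%:E = b^-1%:E)%E.
Proof.
move=> b0; rewrite (@ge0_continuous_FTC2y _ _ (fun y => - b^-1 * expR (- (b * y))) _ 0).
- by rewrite mulr0 oppr0 expR0 mulr1 sub0e EFinN oppeK.
- by move=> y _; exact: expR_ge0.
- by apply: continuous_subspaceT; exact: continuous_expRNM.
- by rewrite -[X in _ --> X](mulr0 (- b^-1)); apply: cvgMr; exact: cvgy_expRN.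
- by move=> y _.
- apply: cvgMr; exact/cvg_at_right_filter/continuous_expRNM.
- move=> y _; rewrite derive1E derive_val /GRing.scale/=; field.
  by rewrite gt_eqF.
Qed.

Lemma integral_gamma_kernel_lty b s : 0 < b -> 0 <= s ->
  (\int[mu]_(y in `[0%R, +oo[) (gamma_kernel b s y)%:E < +oo)%E.
Proof.
move=> b0 s0; have [C C0 Cle] := gamma_kernel_le_expR b0 s0.
have b20 : 0 < b / 2 by rewrite divr_gt0.
have me : measurable_fun (setT : set R) (fun y => (expR (- (b / 2 * y)))%:E).
  apply/measurable_EFinP/measurableT_comp => //.
  by apply: measurableT_comp => //; exact: measurable_funM.
apply: (@le_lt_trans _ _
    (\int[mu]_(y in `[0%R, +oo[) (C%:E * (expR (- (b / 2 * y)))%:E))%E).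
  apply: ge0_le_integral => //.
  - by move=> y _; rewrite lee_fin gamma_kernel_ge0.
  - by apply/measurable_funTS/measurable_EFinP; exact: measurable_gamma_kernel.
  - by apply: measurable_funTS; exact: measurable_funeM.
  - by move=> y; rewrite /= in_itv/= andbT => y0; rewrite -EFinM lee_fin Cle.
rewrite ge0_integralZl ?lee_fin ?(ltW C0)//.
- by rewrite integral_expRN// -EFinM ltry.
- exact: measurable_funTS.
Qed.

(* Adding a multiple of [expR (- (b / 2 * y))] makes the derivative of the
   kernel nonnegative, so that the improper fundamental theorem applies. *)
Lemma integral_gamma_kernel_rec b s : 0 < b -> 1 < s ->
  (b%:E * \int[mu]_(y in `[0%R, +oo[) (gamma_kernel b s y)%:E =
   s%:E * \int[mu]_(y in `[0%R, +oo[) (gamma_kernel b (s - 1) y)%:E)%E.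
Proof.
move=> b0 s1; have s0 : 0 < s by rewrite (lt_trans ltr01).
have b20 : 0 < b / 2 by rewrite divr_gt0.
have [C C0 Cle] := gamma_kernel_le_expR b0 (ltW s0).
(* [D] makes [D * e y] dominate [b * gamma_kernel b s y], the only negative term of [f]. The
   antiderivative [F] has value [- D / (b / 2)] at 0 and limit 0 at infinity. *)
pose D := b * C; have D0 : 0 < D by rewrite mulr_gt0.
pose e y := expR (- (b / 2 * y)).
pose f y := s * gamma_kernel b (s - 1) y - b * gamma_kernel b s y + D * e y.
pose F y := gamma_kernel b s y - D / (b / 2) * e y.
have f0 y : 0 <= y -> 0 <= f y.
  move=> y0; rewrite /f -addrA addr_ge0//.
    by rewrite mulr_ge0 ?(ltW s0) ?gamma_kernel_ge0.
  by rewrite [leRHS]addrC subr_ge0 /D -mulrA ler_wpM2l ?(ltW b0)// Cle.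
(* This makes the kernel of exponent [s - 1] vanish at 0 too, so that [f] is right-continuous
   there. *)
have s10 : 0 < s - 1 by rewrite subr_gt0.
have ce : continuous e by exact: continuous_expRNM.
have dF y : 0 < y -> is_derive y 1 F (f y).
  move=> y0; have dg := is_derive_gamma_kernel b s y0.
  rewrite /F /e; apply: is_derive_eq.
  by rewrite /f /e /GRing.scale/=; field; rewrite gt_eqF.
have If : (\int[mu]_(y in `[0%R, +oo[) (f y)%:E = (D / (b / 2))%:E)%E.
  rewrite (@ge0_continuous_FTC2y _ _ F _ 0)//.
  - by rewrite sub0e /F gamma_kernel0// /e mulr0 oppr0 expR0 mulr1 sub0r -EFinN opprK.
  - apply/continuous_within_itvcyP; split.
      move=> y; rewrite in_itv/= andbT => y0; rewrite /continuous_at /f.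
      apply: cvgD; last by apply: cvgMr; exact: ce.
      by apply: cvgB; apply: cvgMr; exact: continuous_gamma_kernel.
    rewrite /f; apply: cvgD; last by apply: cvgMr; exact/cvg_at_right_filter/ce.
    by apply: cvgB; apply: cvgMr; rewrite gamma_kernel0//; exact: gamma_kernel_cvg0.
  - rewrite /F -[X in _ --> X](subr0 0) -[X in _ - X](mulr0 (D / (b / 2))).
    apply: cvgB; first by apply: cvgy_gamma_kernel => //; exact: ltW.
    by apply: cvgMr; exact: cvgy_expRN.
  - by move=> y y0; exact: (@ex_derive _ _ _ _ _ _ _ (dF _ y0)).
  - rewrite /F; apply: cvgB; first by rewrite gamma_kernel0//; exact: gamma_kernel_cvg0.
    by apply: cvgMr; exact/cvg_at_right_filter/ce.
  - move=> y; rewrite in_itv/= andbT => y0.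
    by rewrite derive1E; apply: (@derive_val _ _ _ _ _ _ _ (dF _ y0)).
have mg (t : R) : measurable_fun (`[0%R, +oo[%classic : set R) (fun y => (gamma_kernel b t y)%:E).
  by apply/measurable_funTS/measurable_EFinP; exact: measurable_gamma_kernel.
have me : measurable_fun (`[0%R, +oo[%classic : set R) (fun y => (e y)%:E).
  by apply/measurable_funTS/measurable_EFinP; exact: continuous_measurable_fun.
have mf : measurable_fun (`[0%R, +oo[%classic : set R) (fun y => (f y)%:E).
  apply/measurable_EFinP/measurable_funD; last first.
    by apply: measurable_funM => //; exact/measurable_EFinP.
  by apply: measurable_funB; apply: measurable_funM => //;
    apply: measurable_funTS; exact: measurable_gamma_kernel.
have Zg (c t : R) : 0 <= c ->
    (c%:E * \int[mu]_(y in `[0%R, +oo[) (gamma_kernel b t y)%:E =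
    \int[mu]_(y in `[0%R, +oo[) (c%:E * (gamma_kernel b t y)%:E))%E.
  move=> c0; rewrite ge0_integralZl//; first exact: mg.
  by move=> y _; rewrite lee_fin gamma_kernel_ge0.
rewrite !Zg ?(ltW b0) ?(ltW s0)//.
have Ie : (\int[mu]_(y in `[0%R, +oo[) (D%:E * (e y)%:E) = (D / (b / 2))%:E)%E.
  rewrite ge0_integralZl ?lee_fin ?(ltW D0)//.
    by rewrite integral_expRN.
  by move=> y _; rewrite lee_fin expR_ge0.
(* Reading the constant as the integral of [f] on the left and of [D * e] on the right makes the two
   sums of integrands equal pointwise. All terms are nonnegative, and the finite constant then
   cancels. *)
have : (\int[mu]_(y in `[0%R, +oo[) (b%:E * (gamma_kernel b s y)%:E) + (D / (b / 2))%:E =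
  \int[mu]_(y in `[0%R, +oo[) (s%:E * (gamma_kernel b (s - 1) y)%:E) + (D / (b / 2))%:E)%E.
  have mZg (c t : R) : measurable_fun (`[0%R, +oo[%classic : set R)
    (fun y => (c%:E * (gamma_kernel b t y)%:E)%E) by apply: measurable_funeM; exact: mg.
  have mDe : measurable_fun (`[0%R, +oo[%classic : set R)
    (fun y => (D%:E * (e y)%:E)%E) by exact: measurable_funeM.
  have Zg0 (c t y : R) : 0 <= c -> (0 <= c%:E * (gamma_kernel b t y)%:E)%E.
    by move=> c0; rewrite -EFinM lee_fin mulr_ge0 ?gamma_kernel_ge0.
  have De0 (y : R) : (0 <= D%:E * (e y)%:E)%E.
    by rewrite -EFinM lee_fin mulr_ge0 ?expR_ge0 ?(ltW D0).
  have f0' (y : R) : `[0%R, +oo[%classic y -> (0 <= (f y)%:E)%E.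
    by rewrite /= in_itv/= andbT lee_fin; exact: f0.
  rewrite -{1}If -{1}Ie -!ge0_integralD//;
    try by [exact: mZg|move=> y _; rewrite Zg0 ?(ltW b0) ?(ltW s0)].
  apply: eq_integral => y _; rewrite -!EFinM -!EFinD; congr EFin.
  by rewrite /f; ring.
by move/(congr1 (fun x => x - (D / (b / 2))%:E)%E); rewrite !addeK.
Qed.

End gamma_kernel.

(** * The joint law of the scale statistics *)

Section chi2.
Context {R : realType}.
Local Notation mu := (@lebesgue_measure R).

(** Serves to integrate [X1] and [X2] out of the joint law, since the estimators involve only [S1]
    and [S2]. *)
Lemma normal_iso_setT (n : nat) (theta : n.-tuple R) (s : R) :
  normal_iso theta s setT = 1%E.
Proof.
elim: n theta => [|n IH] theta /=; first by rewrite indicT.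
under eq_integral do rewrite [X in normal_iso _ _ X](_ : _ = setT)// IH.
rewrite integral_cst// mul1e.
exact: (@probability_setT _ _ _ (normal_prob (thead theta) s)).
Qed.

Lemma Gamma_fun_ge0 (a : R) : 0 <= Gamma_fun a.
Proof. by apply: Rintegral_ge0 => x _; rewrite mulr_ge0 ?powR_ge0 ?expR_ge0. Qed.

Lemma chi2_pdf_ge0 m (x : R) : 0 <= chi2_pdf m x.
Proof.
rewrite /chi2_pdf; case: ifP => // _.
by rewrite divr_ge0 ?mulr_ge0 ?powR_ge0 ?expR_ge0 ?Gamma_fun_ge0.
Qed.

Lemma chi2_pdf_le0 m (x : R) : x <= 0 -> chi2_pdf m x = 0.
Proof. by move=> x0; rewrite /chi2_pdf ltNge x0. Qed.

Lemma measurable_chi2_pdf m : measurable_fun setT (@chi2_pdf R m).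
Proof.
apply: measurable_fun_ifT => //; first exact: measurable_fun_ltr.
apply: measurable_funM => //; apply: measurable_funM => //.
apply: measurableT_comp => //; apply: measurableT_comp => //.
exact: measurable_funM.
Qed.

Lemma scaled_chi2E m (c : R) (A : set R) : measurable A ->
  (scaled_chi2 m c A = \int[mu]_x (\1_A (c * x) * chi2_pdf m x)%:E)%E.
Proof.
move=> mA; rewrite /scaled_chi2 /chi2_prob integral_mkcond.
apply: eq_integral => x _; rewrite patchE indicE.
by rewrite -[x \in _]/(c * x \in A); case: (_ \in A); rewrite ?mul1r ?mul0r.
Qed.

Lemma scaled_chi2_ge0 m (c : R) (A : set R) : (0 <= scaled_chi2 m c A)%E.
Proof. by apply: integral_ge0 => x _; rewrite lee_fin chi2_pdf_ge0. Qed.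

End chi2.

Section scale_mixture.
Context {R : realType}.
Variables (m1 m2 : nat) (rho : R).
Hypothesis rho_gt0 : 0 < rho.
Local Notation mu := (@lebesgue_measure R).

(** Joint density of [z = S1 / S2] and [y = tau * S2 / sigma2 ^+ 2] given [tau], with [rho] the
    ratio of the squared scales: [tau * S1 / sigma1 ^+ 2] equals [y / rho * z], and the factor
    [y / rho] is the Jacobian. *)
Definition ratio_density (z y : R) : R :=
  y / rho * chi2_pdf m1 (y / rho * z) * chi2_pdf m2 y.

(** The argument is [(z, (t, y))]: grouping [t] with [y] lets Tonelli leave [z] as the outermost
    variable. The indicator restricts [t] as in [joint_law]. *)
Definition mixture_density (x : R * (R * R)) : R :=
  \1_[set t : R | 0 < t] x.2.1 * ratio_density x.1 x.2.2.

Lemma ratio_density_ge0 z y : 0 <= ratio_density z y.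
Proof.
rewrite /ratio_density; have [y0|y0] := leP y 0.
  by rewrite (chi2_pdf_le0 _ y0) mulr0.
by rewrite !mulr_ge0 ?chi2_pdf_ge0 ?invr_ge0 ?(ltW y0) ?(ltW rho_gt0).
Qed.

Lemma ratio_density_le0 z y : z <= 0 -> ratio_density z y = 0.
Proof.
move=> z0; rewrite /ratio_density; have [y0|y0] := leP y 0.
  by rewrite (chi2_pdf_le0 _ y0) mulr0.
rewrite [chi2_pdf m1 _]chi2_pdf_le0 ?mulr0 ?mul0r//.
by rewrite mulr_ge0_le0// divr_ge0 ?ltW.
Qed.

Lemma mixture_densityE z t y :
  mixture_density (z, (t, y)) = if 0 < t then ratio_density z y else 0.
Proof.
rewrite /mixture_density/= indicE; case: ifPn => t0.
  by rewrite mem_set// mul1r.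
by rewrite memNset ?mul0r//=; exact/negP.
Qed.

Lemma mixture_density_ge0 x : 0 <= mixture_density x.
Proof. by rewrite mulr_ge0 ?ratio_density_ge0. Qed.

Lemma measurable_pos : measurable [set t : R | 0 < t].
Proof. by rewrite -set_itvoy. Qed.

Lemma measurable_ratio_density :
  measurable_fun setT (fun x : R * R => ratio_density x.1 x.2).
Proof.
apply: measurable_funM.
  apply: measurable_funM; first exact: measurable_funM.
  apply: measurableT_comp; first exact: measurable_chi2_pdf.
  by apply: measurable_funM => //; exact: measurable_funM.
by apply: measurableT_comp => //; exact: measurable_chi2_pdf.
Qed.

Lemma measurable_mixture_density : measurable_fun setT mixture_density.
Proof.
apply: measurable_funM.
  apply: measurableT_comp; first by apply: measurable_indic; exact: measurable_pos.
  exact: measurableT_comp.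
rewrite [X in measurable_fun _ X](_ : _ =
  (fun x : R * R => ratio_density x.1 x.2) \o (fun x : R * (R * R) => (x.1, x.2.2)))//.
apply: measurableT_comp; first exact: measurable_ratio_density.
by apply: measurable_fun_pair => //; exact: measurableT_comp.
Qed.

End scale_mixture.

(** On each sign the inverse is a real power, up to signs, and real powers are measurable; at 0 it
    takes the default value 0. *)
Lemma measurable_invr (R : realType) : measurable_fun setT (@GRing.inv R).
Proof.
rewrite (_ : @GRing.inv R = fun x => if 0 < x then x `^ (-1)
    else if x < 0 then - (- x) `^ (-1) else 0); last first.
  apply/funext => x; have [x0|x0|->] := ltrgt0P x; last by rewrite invr0.
    by rewrite powR_inv1 ?ltW.
  by rewrite powR_inv1 ?invrN ?opprK// oppr_ge0 ltW.
apply: measurable_fun_ifT => //; first exact: measurable_fun_ltr.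
apply: measurable_fun_ifT => //; first exact: measurable_fun_ltr.
apply: measurableT_comp => //.
exact: (measurableT_comp (measurable_powR _)).
Qed.

Section mixture_law.
Context (d : measure_display) (Omega : measurableType d) (R : realType).
Variables (m1 m2 : nat) (s1 s2 : R).
Hypotheses (s1_gt0 : 0 < s1) (s2_gt0 : 0 < s2).
Variables (Pi : {sigma_finite_measure set R -> \bar R}) (P : probability Omega R).
Variables S1 S2 : {mfun Omega >-> R}.
Hypothesis law : forall B1 B2 : set R, measurable B1 -> measurable B2 ->
  P (S1 @^-1` B1 `&` S2 @^-1` B2) =
  (\int[Pi]_(t in [set t : R | (0 < t)%R])
    (scaled_chi2 m1 (s1 ^+ 2 / t)%R B1 * scaled_chi2 m2 (s2 ^+ 2 / t)%R B2))%E.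

Local Notation mu := (@lebesgue_measure R).
Local Notation rho := (s1 ^+ 2 / s2 ^+ 2).
Local Notation jd := (mixture_density m1 m2 rho).
Local Notation lam := (mu \x sigma_finite_prod Pi mu)%E.

Let rho_gt0 : 0 < rho. Proof. by rewrite divr_gt0 ?exprn_gt0. Qed.

(** In the coordinates [(z, (t, y))], [v t y] is the value of [S2], and [T] below gives the pair
    [(S1, S2)]. *)
Let v (t y : R) : R := s2 ^+ 2 * (y / t).

Let T (x : R * (R * R)) : R * R := (x.1 * v x.2.1 x.2.2, v x.2.1 x.2.2).

Let measurable_v : measurable_fun setT (fun x : R * R => v x.1 x.2).
Proof.
apply: measurable_funM => //; apply: measurable_funM => //.
by apply: measurableT_comp => //; exact: measurable_invr.
Qed.

Let measurable_v2 : measurable_fun setT (fun x : R * (R * R) => v x.2.1 x.2.2).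
Proof. by apply: (measurableT_comp measurable_v). Qed.

Let measurable_T : measurable_fun setT T.
Proof. by apply: measurable_fun_pair => //; exact: measurable_funM. Qed.

Let mjd : measurable_fun setT jd.
Proof. exact: measurable_mixture_density. Qed.

(** Substitute [x = y / rho * z] in the chi-square integral; the scale [s1 ^+ 2 / t] then turns [x]
    into [z * v t y]. *)
Let inner (t y : R) (B1 : set R) : measurable B1 -> 0 < t -> 0 < y ->
  (\int[mu]_z (\1_B1 (z * v t y) * (y / rho * chi2_pdf m1 (y / rho * z)))%:E =
   scaled_chi2 m1 (s1 ^+ 2 / t)%R B1)%E.
Proof.
move=> mB1 t0 y0; rewrite scaled_chi2E//.
have c0 : 0 < y / rho by rewrite divr_gt0.
rewrite [RHS](ge0_integral_scale c0).
- apply: eq_integral => z _; rewrite -EFinM [in RHS]mulrCA.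
  suff -> : s1 ^+ 2 / t * (y / rho * z) = z * v t y by [].
  by rewrite /v; field; rewrite !gt_eqF.
- apply/measurable_EFinP/measurable_funM; last exact: measurable_chi2_pdf.
  apply: measurableT_comp; first exact: measurable_indic.
  exact: measurable_funM.
- by move=> x; rewrite lee_fin mulr_ge0 ?chi2_pdf_ge0.
Qed.

(** On a rectangle the indicator splits, and the integrals over [z] and [y] produce the two
    chi-square factors of [law]. *)
Let rectangle (B1 B2 : set R) : measurable B1 -> measurable B2 ->
  P (S1 @^-1` B1 `&` S2 @^-1` B2) =
  (\int[lam]_x (\1_(B1 `*` B2) (T x) * jd x)%:E)%E.
Proof.
move=> mB1 mB2; rewrite law//.
pose G (x : R * (R * R)) := (\1_(B1 `*` B2) (T x) * jd x)%:E.
have G0 x : (0 <= G x)%E by rewrite lee_fin mulr_ge0 ?mixture_density_ge0.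
have mG : measurable_fun setT G.
  apply/measurable_EFinP/measurable_funM => //.
  by apply: measurableT_comp => //; apply: measurable_indic; exact: measurableX.
(* Tonelli is applied twice to put [t] outermost and [z] innermost: the substitution of [inner]
   requires [t] and [y] fixed. *)
rewrite [RHS](@fubini_tonelli2 _ _ _ _ _ mu (sigma_finite_prod Pi mu) G)//.
rewrite [RHS](@fubini_tonelli1 _ _ _ _ _ Pi mu (fubini_G mu G))//; last 2 first.
- exact: measurable_fun_fubini_tonelli_G.
- by move=> x; apply: integral_ge0.
rewrite integral_mkcond; apply: eq_integral => t _.
rewrite patchE /fubini_F /fubini_G /G /T /=.
rewrite -[t \in _]/(t \in [set t : R | 0 < t]).
have [t0|t0] := boolP (0 < t); last first.
  rewrite memNset; last exact/negP.
  rewrite integral0_eq// => y _; rewrite integral0_eq// => z _.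
  by rewrite mixture_densityE (negbTE t0) mulr0.
rewrite mem_set//.
rewrite [X in (_ * X)%E]scaled_chi2E// -ge0_integralZl//; last 3 first.
- apply/measurable_EFinP/measurable_funM; last exact: measurable_chi2_pdf.
  apply: measurableT_comp; first exact: measurable_indic.
  exact: measurable_funM.
- by move=> x _; rewrite lee_fin mulr_ge0 ?chi2_pdf_ge0.
- exact: scaled_chi2_ge0.
apply: eq_integral => y _.
have [y0|y0] := leP y 0.
  rewrite chi2_pdf_le0// mulr0 mule0 integral0_eq// => z _.
  by rewrite mixture_densityE t0 /ratio_density (chi2_pdf_le0 _ y0) !mulr0.
have mq : measurable_fun [set: R]
    (fun z : R => (\1_B1 (z * v t y) * (y / rho * chi2_pdf m1 (y / rho * z)))%:E).
  apply/measurable_EFinP/measurable_funM.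
    apply: measurableT_comp; first exact: measurable_indic.
    exact: measurable_funM.
  apply: measurable_funM => //; apply: measurableT_comp; first exact: measurable_chi2_pdf.
  exact: measurable_funM.
have q0 z : (0 <= (\1_B1 (z * v t y) * (y / rho * chi2_pdf m1 (y / rho * z)))%:E)%E.
  rewrite lee_fin !mulr_ge0 ?chi2_pdf_ge0 ?(ltW y0)//.
  by rewrite invr_ge0 ltW.
have c0 : (0 <= (\1_B2 (s2 ^+ 2 / t * y) * chi2_pdf m2 y)%:E)%E.
  by rewrite lee_fin mulr_ge0 ?chi2_pdf_ge0.
rewrite -(inner mB1 t0 y0) muleC.
apply: (etrans (esym (@ge0_integralZl _ _ _ mu setT measurableT _ mq _ (fun z _ => q0 z) c0))).
apply: eq_integral => z _; rewrite -[LHS]EFinM.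
rewrite mixture_densityE t0 /ratio_density.
have -> : \1_(B1 `*` B2) (z * v t y, v t y) = \1_B1 (z * v t y) * \1_B2 (v t y) :> R.
  by rewrite !indicE in_setX/= -natrM mulnb.
have -> : s2 ^+ 2 / t * y = v t y by rewrite /v mulrAC mulrA.
by rewrite mulrACA [X in X * _]mulrC [X in _ * X]mulrC.
Qed.

(** Both sides integrate [H] against image measures on the plane, the law of [(S1, S2)] and the
    image under [T] of the measure with density [jd]. They agree on measurable rectangles, a
    generating family closed under intersection. *)
Lemma mixture_expectation_pair (H : R * R -> \bar R) : measurable_fun setT H ->
  (forall x, 0 <= H x)%E ->
  (\int[P]_w H (S1 w, S2 w) = \int[lam]_x (H (T x) * (jd x)%:E))%E.
Proof.
move=> mH H0.
have mS : measurable_fun setT (fun w => (S1 w, S2 w)).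
  exact: measurable_fun_pair.
pose S : {mfun Omega >-> (R * R)%type} := HB.pack (fun w => (S1 w, S2 w))
  (isMeasurableFun.Build _ _ _ _ _ mS).
pose D := mdensity lam (mixture_density_ge0 m1 m2 rho_gt0) mjd.
have mT : measurable_fun
    [set: (measurableTypeR R * (R * measurableTypeR R))%type] T by exact: measurable_T.
pose T' : {mfun (measurableTypeR R * (R * measurableTypeR R))%type >-> (R * R)%type} :=
  HB.pack T (isMeasurableFun.Build _ _ _ _ _ mT).
transitivity (\int[pushforward P S]_x H x)%E.
  by rewrite ge0_integral_pushforward.
transitivity (\int[pushforward D T']_x H x)%E; last first.
  rewrite ge0_integral_pushforward// preimage_setT.
  rewrite ge0_integral_mdensity//; first exact: (measurableT_comp mH mT).
  by move=> x; exact: H0.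
apply: eq_measure_integral => A mA _.
apply: (measure_unique [set B1 `*` B2 | B1 in measurable & B2 in measurable]
  (fun=> setT)) => //.
- by rewrite measurable_prod_measurableType.
- move=> _ _ [A1 mA1 [A2 mA2 <-]] [B1 mB1 [B2 mB2 <-]]; rewrite -setXI.
  by exists (A1 `&` B1); [exact: measurableI|exists (A2 `&` B2) => //; exact: measurableI].
- by move=> _; exists setT => //; exists setT => //; rewrite setXTT.
- by rewrite bigcup_const//; exists 0.
- move=> _ [B1 mB1 [B2 mB2 <-]].
  transitivity (P (S1 @^-1` B1 `&` S2 @^-1` B2)) => //.
  rewrite rectangle// /pushforward/= /D /mdensity [RHS]integral_mkcond.
  apply: eq_integral => x _; rewrite patchE indicE.
  rewrite -[x \in _]/(T x \in B1 `*` B2).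
  by case: (_ \in _); rewrite ?mul1r ?mul0r.
- by move=> _; rewrite -[X in (X < _)%E]/(P setT) probability_setT ltry.
Qed.

(** The loss depends on the data through [S1 / S2] and [S2 / s2 ^+ 2], which become [z] and [y / t].
    Keeping [z] outermost allows the risk to be minimised separately at each [z]. *)
Lemma mixture_expectation (K : R -> R -> \bar R) :
  measurable_fun setT (fun x : R * R => K x.1 x.2) -> (forall z u, 0 <= K z u)%E ->
  (\int[P]_w K (S1 w / S2 w)%R (S2 w / s2 ^+ 2)%R =
   \int[mu]_z \int[sigma_finite_prod Pi mu]_p
     (K z (p.2 / p.1)%R * (jd (z, p))%:E))%E.
Proof.
move=> mK K0.
pose H (x : R * R) := K (x.1 / x.2) (x.2 / s2 ^+ 2).
have mH : measurable_fun setT H.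
  have mg : measurable_fun setT (fun x : R * R => (x.1 / x.2, x.2 / s2 ^+ 2)); last first.
    exact: (measurableT_comp mK mg).
  apply: measurable_fun_pair.
    apply: measurable_funM => //.
    by apply: measurableT_comp => //; exact: measurable_invr.
  exact: measurable_funM.
rewrite (mixture_expectation_pair mH)//; last by move=> x; exact: K0.
pose G (x : R * (R * R)) := (H (T x) * (jd x)%:E)%E.
rewrite [LHS](@fubini_tonelli1 _ _ _ _ _ mu (sigma_finite_prod Pi mu) G).
- apply: eq_integral => z _; apply: eq_integral => -[t y] _; rewrite /G.
  (* Off [t > 0] and [y > 0] the density vanishes; on that region [v t y] is nonzero, so dividing by
     it recovers [z]. *)
  rewrite mixture_densityE; case: ifPn => t0; last by rewrite !mule0.
  have [y0|y0] := leP y 0.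
    by rewrite /ratio_density (chi2_pdf_le0 _ y0) mulr0 !mule0.
  have v0 : v t y != 0 by rewrite gt_eqF// /v mulr_gt0 ?exprn_gt0// divr_gt0.
  rewrite /H /T/= mulfK// /v mulrAC mulfV ?mul1r// gt_eqF// exprn_gt0//.
- apply: emeasurable_funM; last exact/measurable_EFinP.
  exact: (measurableT_comp mH).
- by move=> x; rewrite mule_ge0 ?K0// lee_fin mixture_density_ge0.
Qed.

End mixture_law.

(** * The risk at a fixed ratio *)

Section positive_mixing.
Context {R : realType} (Pi : probability R R).
Hypothesis Pi_pos : Pi [set t : R | 0 < t] = 1%E.

(** On positive [t] the integrand is nonnegative, as Tonelli requires; [Pi] is carried by this set,
    so [inv_moment] has the same value. *)
Definition pos_inv_moment (k : nat) : \bar R :=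
  (\int[Pi]_(t in [set t : R | (0 < t)%R]) (t ^- k)%:E)%E.

Lemma measurable_invX (k : nat) : measurable_fun setT (fun t : R => t ^- k).
Proof.
rewrite [X in measurable_fun _ X](_ : _ = (fun t : R => t^-1 ^+ k)); last first.
  by apply/funext => t; rewrite exprVn.
by apply: measurable_funX; exact: measurable_invr.
Qed.

Lemma inv_momentE (k : nat) : inv_moment Pi k = pos_inv_moment k.
Proof.
rewrite /inv_moment unlock /pos_inv_moment [RHS]integral_mkcond.
apply: ae_eq_integral => //.
- by apply/measurable_EFinP; exact: measurable_invX.
- apply/(measurable_restrictT _ (@measurable_pos R)).
  by apply: measurable_funTS; apply/measurable_EFinP; exact: measurable_invX.
- exists (~` [set t : R | 0 < t]); split.
  + by apply: measurableC; exact: (@measurable_pos R).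
  + apply: (etrans (probability_setC Pi (@measurable_pos R))).
    by rewrite [X in (_ - X)%E]Pi_pos subee.
  + move=> t /= nt t0; apply: nt => _.
    by rewrite patchE mem_set.
Qed.

Lemma pos_inv_moment_gt0 (k : nat) : (0 < pos_inv_moment k)%E.
Proof.
apply: integral_gt0; first exact: measurable_pos.
- by apply: measurable_funTS; apply/measurable_EFinP; exact: measurable_invX.
- by move=> t t0; rewrite lte_fin invr_gt0 exprn_gt0.
- by rewrite [X in (_ < X)%E]Pi_pos lte01.
Qed.

End positive_mixing.

(** The contribution of the ratio [z] to the risk when [S2] is multiplied by [c]; it carries the
    density of [z] and is not normalised to a conditional expectation. *)
Definition fiber_risk (R : realType) (Pi : probability R R) (m1 m2 : nat)
    (rho z c : R) : \bar R :=
  (\int[sigma_finite_prod Pi (@lebesgue_measure R)]_p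
    ((c * (p.2 / p.1) - 1) ^+ 2 * mixture_density m1 m2 rho (z, p))%:E)%E.

Lemma fiber_risk_ge0 (R : realType) (Pi : probability R R) (m1 m2 : nat) (rho z c : R) :
  0 < rho -> (0 <= fiber_risk Pi m1 m2 rho z c)%E.
Proof.
move=> rho0; apply: integral_ge0 => p _.
by rewrite lee_fin mulr_ge0 ?sqr_ge0 ?mixture_density_ge0.
Qed.

Lemma fiber_risk_le0 (R : realType) (Pi : probability R R) (m1 m2 : nat) (rho z c : R) :
  0 < rho -> z <= 0 -> fiber_risk Pi m1 m2 rho z c = 0%E.
Proof.
move=> rho0 z0; rewrite /fiber_risk integral0_eq// => -[t y] _.
by rewrite mixture_densityE ratio_density_le0// if_same mulr0.
Qed.

(** * The fiber risk as a quadratic polynomial in the multiplier *)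

Section fiber.
Context {R : realType} (Pi : probability R R) (m1 m2 : nat) (rho : R).
Hypotheses (Pi_pos : Pi [set t : R | 0 < t] = 1%E).
Hypotheses (m1_gt0 : (0 < m1)%N) (m2_gt0 : (0 < m2)%N) (rho_gt0 : 0 < rho).
Hypotheses (Gamma1_gt0 : 0 < Gamma_fun (m1%:R / 2 : R)).
Hypotheses (Gamma2_gt0 : 0 < Gamma_fun (m2%:R / 2 : R)).
Local Notation mu := (@lebesgue_measure R).
Local Notation pi1 := (pos_inv_moment Pi 1).
Local Notation pi2 := (pos_inv_moment Pi 2).
Hypotheses (pi1_fin : (pi1 < +oo)%E) (pi2_fin : (pi2 < +oo)%E).
Local Notation jd := (mixture_density m1 m2 rho).
Local Notation rd := (ratio_density m1 m2 rho).
Local Notation PM := (sigma_finite_prod Pi mu).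

(** For [y > 0], [y ^+ k * rd z y] is a Gamma kernel in [y]: [beta] is its rate, [K] the factor free
    of [y], and [e k] the total exponent of [y], including the one from the Jacobian. *)
Let beta (z : R) : R := (1 + z / rho) / 2.

Let K (z : R) : R := (z / rho) `^ (m1%:R / 2 - 1) /
  (rho * (2 `^ (m1%:R / 2) * Gamma_fun (m1%:R / 2)) *
    (2 `^ (m2%:R / 2) * Gamma_fun (m2%:R / 2))).

Let e (k : nat) : R := (m1 + m2)%:R / 2 - 1 + k%:R.

Let K_gt0 z : 0 < z -> 0 < K z.
Proof.
move=> z0; rewrite divr_gt0//; first by rewrite powR_gt0// divr_gt0.
by rewrite mulr_gt0// ?[X in 0 < rho * X]mulr_gt0 ?mulr_gt0 ?powR_gt0.
Qed.

Let beta_gt0 z : 0 < z -> 0 < beta z.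
Proof. by move=> z0; rewrite divr_gt0// addr_gt0// divr_gt0. Qed.

Let e_ge0 k : 0 <= e k.
Proof.
rewrite addr_ge0// subr_ge0 ler_pdivlMr// mul1r ler_nat.
by rewrite (leq_add m1_gt0 m2_gt0).
Qed.

Let ratio_densityE z y k : 0 < z -> 0 < y ->
  y ^+ k * rd z y = K z * gamma_kernel (beta z) (e k) y.
Proof.
move=> z0 y0; have yz0 : 0 < y / rho * z by rewrite mulr_gt0 ?divr_gt0.
rewrite /ratio_density /chi2_pdf yz0 y0 /K /gamma_kernel /beta /e.
have -> : y / rho * z = y * (z / rho) by rewrite mulrAC mulrA.
rewrite (@powRM _ y (z / rho)) ?(ltW y0) ?divr_ge0 ?(ltW z0) ?(ltW rho_gt0)//.
have -> : (m1 + m2)%:R / 2 - 1 + k%:R =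
    (m1%:R / 2 - 1) + (m2%:R / 2 - 1) + (1 + k%:R) :> R.
  by rewrite natrD; field.
have yn0 : y != 0 by rewrite gt_eqF.
set a1 := m1%:R / 2 - 1; set a2 := m2%:R / 2 - 1; move: a1 a2 => a1 a2.
have yD r s : y `^ (r + s) = y `^ r * y `^ s by rewrite powRD// yn0 implybT.
rewrite 3!yD powRr1 ?(ltW y0)// powR_mulrn ?(ltW y0)//.
have -> : - ((1 + z / rho) / 2 * y) = - (y * (z / rho) / 2) - y / 2.
  by field; rewrite gt_eqF.
rewrite expRD.
have C1_neq0 : 2 `^ (m1%:R / 2) * Gamma_fun (m1%:R / 2) != 0 :> R.
  by rewrite gt_eqF// mulr_gt0 ?powR_gt0.
have C2_neq0 : 2 `^ (m2%:R / 2) * Gamma_fun (m2%:R / 2) != 0 :> R.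
  by rewrite gt_eqF// mulr_gt0 ?powR_gt0.
have rho_neq0 : rho != 0 by rewrite gt_eqF.
move: (2 `^ _ * _) C1_neq0 (2 `^ _ * _) C2_neq0 => C1 C1_neq0 C2 C2_neq0.
move: (expR _) (expR _) (y `^ a1) (y `^ a2) ((z / rho) `^ a1) => E1 E2 Y1 Y2 Z.
move: (y ^+ k) => Yk.
field.
by rewrite C1_neq0 C2_neq0.
Qed.

Let J k z : \bar R := (\int[mu]_(y in `[0%R, +oo[) (gamma_kernel (beta z) (e k) y)%:E)%E.

Let ratio_moment k z : 0 < z ->
  (\int[mu]_y (y ^+ k * rd z y)%:E = (K z)%:E * J k z)%E.
Proof.
move=> z0; rewrite /J -integral_itv_obnd_cbnd; last first.
  by apply/measurable_EFinP/measurable_funTS; exact: measurable_gamma_kernel.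
rewrite -ge0_integralZl//; last 3 first.
- by apply/measurable_EFinP/measurable_funTS; exact: measurable_gamma_kernel.
- by move=> y _; rewrite lee_fin gamma_kernel_ge0.
- by rewrite lee_fin ltW// K_gt0.
rewrite [RHS]integral_mkcond; apply: eq_integral => y _.
rewrite patchE mem_setE /= in_itv/= andbT; case: ifPn => y0.
  by rewrite ratio_densityE.
rewrite -leNgt in y0.
by rewrite /ratio_density (chi2_pdf_le0 _ y0) !mulr0.
Qed.

Let measurable_jd z : measurable_fun setT (fun p : R * R => jd (z, p)).
Proof.
apply: (measurableT_comp (measurable_mixture_density m1 m2 rho)).
exact: measurable_fun_pair.
Qed.

Let measurable_quot : measurable_fun setT (fun p : R * R => p.2 / p.1).
Proof.
by apply: measurable_funM => //; apply: measurableT_comp => //; exact: measurable_invr.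
Qed.

Let G k z (p : R * R) := ((p.2 / p.1) ^+ k * jd (z, p))%:E.

Let mG k z : measurable_fun setT (G k z).
Proof.
apply/measurable_EFinP/measurable_funM; last exact: measurable_jd.
by apply: measurable_funX; exact: measurable_quot.
Qed.

Let GE k z t y : G k z (t, y) =
  if 0 < t then ((t ^- k)%:E * (y ^+ k * rd z y)%:E)%E else 0%E.
Proof.
rewrite /G mixture_densityE/=; case: ifP => _; last by rewrite mulr0.
by rewrite -EFinM expr_div_n [in RHS]mulrA (mulrC (t ^- k)).
Qed.

Let rdX_ge0 k z y : 0 <= y ^+ k * rd z y.
Proof.
have [y0|y0] := leP y 0; last first.
  by rewrite mulr_ge0 ?ratio_density_ge0// exprn_ge0// ltW.
by rewrite /ratio_density (chi2_pdf_le0 _ y0) !mulr0.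
Qed.

Let G_ge0 k z p : (0 <= G k z p)%E.
Proof.
case: p => t y; rewrite GE; case: ifP => // t0.
by rewrite mule_ge0 ?lee_fin ?rdX_ge0// invr_ge0 exprn_ge0// ltW.
Qed.

(** Unnormalised [k]-th moment of [S2 / sigma2 ^+ 2] at ratio [z]. For [k] equal to 0, 1 and 2 these
    give the coefficients of the quadratic polynomial. *)
Let Mom k z : \bar R := (\int[PM]_p G k z p)%E.

(** The density does not depend on [t] for [t > 0], so the double integral is the product of an
    inverse moment of [tau] and a Gamma integral. *)
Let MomE k z : 0 < z -> (Mom k z = pos_inv_moment Pi k * ((K z)%:E * J k z))%E.
Proof.
move=> z0; rewrite /Mom [LHS](@fubini_tonelli1 _ _ _ _ _ Pi mu (G k z) (mG k z) (G_ge0 k z)).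
have mq : measurable_fun [set: R] (fun y => (y ^+ k * rd z y)%:E).
  apply/measurable_EFinP/measurable_funM; first exact: measurable_funX.
  apply: (measurableT_comp (measurable_ratio_density m1 m2 rho)
    (g := fun y : R => (z, y))).
  exact: measurable_fun_pair.
rewrite -ratio_moment// /pos_inv_moment.
set N := (\int[mu]_y (y ^+ k * rd z y)%:E)%E.
have N0 : (0 <= N)%E by apply: integral_ge0 => y _; rewrite lee_fin rdX_ge0.
have mt : measurable_fun [set t : R | 0 < t] (fun t => (t ^- k)%:E).
  by apply: measurable_funTS; apply/measurable_EFinP; exact: measurable_invX.
have t0 (t : R) : [set t | 0 < t] t -> (0 <= (t ^- k)%:E)%E.
  by move=> /= t0; rewrite lee_fin invr_ge0 exprn_ge0// ltW.
apply: (etrans _ (@ge0_integralZr _ _ _ Pi _ (@measurable_pos R) _ mt _ t0 N0)).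
rewrite [RHS]integral_mkcond; apply: eq_integral => t _.
rewrite patchE /fubini_F -[t \in _]/(t \in [set t : R | 0 < t]).
under eq_integral do rewrite GE.
have [tp|tp] := boolP (0 < t); last first.
  rewrite memNset; last exact/negP.
  by rewrite integral0_eq.
rewrite mem_set//.
have q0 (y : R) : [set: R] y -> (0 <= (y ^+ k * rd z y)%:E)%E.
  by move=> _; rewrite lee_fin rdX_ge0.
exact: (@ge0_integralZl _ _ _ mu setT measurableT _ mq _ q0 (t0 _ tp)).
Qed.

Let J_fin k z : 0 < z -> J k z \is a fin_num.
Proof.
move=> z0; rewrite ge0_fin_numE; last first.
  by apply: integral_ge0 => y _; rewrite lee_fin gamma_kernel_ge0.
by apply: integral_gamma_kernel_lty => //; exact: beta_gt0.
Qed.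

Let J_gt0 k z : 0 < z -> (0 < J k z)%E.
Proof.
move=> z0; rewrite /J -integral_itv_obnd_cbnd; last first.
  by apply/measurable_EFinP/measurable_funTS; exact: measurable_gamma_kernel.
apply: integral_gt0 => //.
- by apply/measurable_EFinP/measurable_funTS; exact: measurable_gamma_kernel.
- by move=> y; rewrite /= in_itv/= andbT lte_fin => y0; exact: gamma_kernel_gt0.
- by rewrite [X in (_ < X)%E]lebesgue_measure_itv/= !ltry.
Qed.

(** The Gamma recursion at exponent [e 2], where [e 2 - 1 = e 1]. It is the source of the factor
    [(1 + z / rho) / (m1 + m2 + 2)], which is [beta z / e 2]. *)
Let J_rec z : 0 < z -> beta z * fine (J 2 z) = e 2 * fine (J 1 z).
Proof.
move=> z0; apply: EFin_inj; rewrite !EFinM (fineK (J_fin 2 z0)) (fineK (J_fin 1 z0)) /J.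
have e21 : e 2 - 1 = e 1 by rewrite /e; ring.
rewrite -e21; apply: integral_gamma_kernel_rec; first exact: beta_gt0.
rewrite -subr_gt0 e21 (lt_le_trans ltr01)// /e lerDr.
by have := e_ge0 0; rewrite /e addr0.
Qed.

(** The square expanded, with the linear term moved to the left: as [c >= 0], every integrand is
    nonnegative and additivity holds before finiteness is known. *)
Let fiber_risk_quadratic c z : 0 <= c ->
  (fiber_risk Pi m1 m2 rho z c + (2 * c)%:E * Mom 1 z =
   (c ^+ 2)%:E * Mom 2 z + Mom 0 z)%E.
Proof.
move=> c0.
pose F (p : R * R) := ((c * (p.2 / p.1) - 1) ^+ 2 * jd (z, p))%:E.
have mF : measurable_fun setT F.
  apply/measurable_EFinP/measurable_funM; last exact: measurable_jd.
  apply: measurable_funX; apply: measurable_funB => //.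
  by apply: measurable_funM => //; exact: measurable_quot.
have F0 p : (0 <= F p)%E by rewrite lee_fin mulr_ge0 ?sqr_ge0 ?mixture_density_ge0.
have ZG k b : 0 <= b ->
    (b%:E * Mom k z = \int[PM]_p (b%:E * G k z p))%E.
  move=> b0; apply/esym.
  exact: (@ge0_integralZl _ _ _ PM setT measurableT _ (mG k z) _ (fun p _ => G_ge0 k z p)).
have mZG k b : measurable_fun setT (fun p => (b%:E * G k z p)%E).
  by apply: measurable_funeM; exact: mG.
have ZG0 k b p : 0 <= b -> (0 <= b%:E * G k z p)%E.
  by move=> b0; rewrite mule_ge0.
have c20 : 0 <= 2 * c by rewrite mulr_ge0.
rewrite ZG// ZG ?sqr_ge0//.
apply: (etrans (esym (@ge0_integralD _ _ _ PM setT measurableT F _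
  (fun p _ => F0 p) mF (fun p _ => ZG0 1 _ p c20) (mZG 1 _)))).
apply: (etrans _ (@ge0_integralD _ _ _ PM setT measurableT _ _
  (fun p _ => ZG0 2 _ p (sqr_ge0 c)) (mZG 2 _) (fun p _ => G_ge0 0 z p) (mG 0 z))).
apply: eq_integral => p _; rewrite /F /G -!EFinM -!EFinD; congr EFin.
by move: (p.2 / p.1) (jd _) => q j; rewrite expr0; ring.
Qed.

Let Mom0_fin : (pos_inv_moment Pi 0 < +oo)%E.
Proof.
rewrite /pos_inv_moment; under eq_integral do rewrite expr0 invr1.
by rewrite integral_cst ?mul1e ?[X in (X < _)%E]Pi_pos ?ltry//; exact: measurable_pos.
Qed.

Let Mom_fin k z : (pos_inv_moment Pi k < +oo)%E -> 0 < z -> Mom k z \is a fin_num.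
Proof.
move=> kfin z0; rewrite MomE// fin_numM ?fin_numM ?J_fin//.
by rewrite ge0_fin_numE ?ltW// pos_inv_moment_gt0.
Qed.

Let fine_MomE k z : (pos_inv_moment Pi k < +oo)%E -> 0 < z ->
  fine (Mom k z) = fine (pos_inv_moment Pi k) * (K z * fine (J k z)).
Proof.
move=> kfin z0; rewrite MomE//.
have f : pos_inv_moment Pi k \is a fin_num.
  by rewrite ge0_fin_numE ?ltW// pos_inv_moment_gt0.
by rewrite -{1}(fineK f) -{1}(fineK (J_fin k z0)).
Qed.

Let fine_J_gt0 k z : 0 < z -> 0 < fine (J k z).
Proof. by move=> z0; rewrite -lte_fin (fineK (J_fin k z0)); exact: J_gt0. Qed.

Let fine_inv_moment_gt0 k : (pos_inv_moment Pi k < +oo)%E ->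
  0 < fine (pos_inv_moment Pi k).
Proof. by move=> kfin; rewrite fine_gt0// kfin andbT pos_inv_moment_gt0. Qed.

Lemma fiber_risk_fin z c : 0 <= c -> fiber_risk Pi m1 m2 rho z c \is a fin_num.
Proof.
move=> c0; have [z0|z0] := leP z 0.
  by rewrite fiber_risk_le0.
have := fiber_risk_quadratic z c0.
rewrite -(fineK (Mom_fin pi1_fin z0)) -(fineK (Mom_fin pi2_fin z0)).
rewrite -(fineK (Mom_fin Mom0_fin z0)) -!EFinM -EFinD.
(* An infinite fiber risk would contradict the identity, whose other terms are all finite. *)
by case: (fiber_risk _ _ _ _ _ _).
Qed.

(** A quadratic polynomial with positive leading coefficient [Mom 2 z] strictly decreases up to its
    vertex [Mom 1 z / Mom 2 z], and the bound imposed on [c'] is this vertex. *)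
Lemma fiber_risk_lt z c c' : 0 < z -> 0 <= c -> c < c' ->
  c' <= (1 + z / rho) / (m1 + m2 + 2)%:R * (fine pi1 / fine pi2) ->
  (fiber_risk Pi m1 m2 rho z c' < fiber_risk Pi m1 m2 rho z c)%E.
Proof.
move=> z0 c0 cc' c'le; have c'0 : 0 <= c' by rewrite ltW// (le_lt_trans c0).
have p1 := fine_inv_moment_gt0 pi1_fin; have p2 := fine_inv_moment_gt0 pi2_fin.
have j1 := fine_J_gt0 1 z0; have K0 := K_gt0 z0.
have a0 : 0 < fine (Mom 2 z).
  rewrite (fine_MomE pi2_fin z0).
  exact: (mulr_gt0 p2 (mulr_gt0 K0 (fine_J_gt0 2 z0))).
have c'a : c' * fine (Mom 2 z) <= fine (Mom 1 z).
  apply: (le_trans (ler_wpM2r (ltW a0) c'le)).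
  rewrite (fine_MomE pi1_fin z0) (fine_MomE pi2_fin z0).
  have n0 : (m1 + m2 + 2)%:R != 0 :> R by rewrite pnatr_eq0 addn2.
  have z1 : 0 < 1 + z / rho by rewrite addr_gt0// divr_gt0.
  have -> : fine (J 2 z) = (m1 + m2 + 2)%:R / (1 + z / rho) * fine (J 1 z).
    have b0 : beta z != 0 by rewrite gt_eqF// beta_gt0.
    apply: (mulfI b0); rewrite J_rec// /beta /e natrD mulrA; congr (_ * _).
    by move: (1 + z / rho) z1 => u u0; field; rewrite gt_eqF.
  move: (1 + z / rho) (m1 + m2 + 2)%:R z1 n0 => u n u0 n0.
  move: (K z) (fine (J 1 z)) (fine pi1) (fine pi2) p2 => k j q1 q2 q20.
  (* The upper bound on [c'] is exactly the vertex, so equality holds here. *)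
  rewrite le_eqVlt; apply/orP; left; apply/eqP.
  by field; rewrite n0 !gt_eqF.
have qc := fiber_risk_quadratic z c0; have qc' := fiber_risk_quadratic z c'0.
move: qc qc'.
rewrite -(fineK (fiber_risk_fin z c0)) -(fineK (fiber_risk_fin z c'0)).
rewrite -(fineK (Mom_fin pi1_fin z0)) -(fineK (Mom_fin pi2_fin z0)).
rewrite -(fineK (Mom_fin Mom0_fin z0)) -!EFinM -!EFinD => -[qc] [qc'].
rewrite lte_fin.
move: (fine (fiber_risk _ _ _ _ _ c)) (fine (fiber_risk _ _ _ _ _ c')) qc qc' => r r'.
move: (fine (Mom 2 z)) (fine (Mom 1 z)) (fine (Mom 0 z)) a0 c'a => a b n a0 c'a qc qc'.
have {qc}-> : r = c ^+ 2 * a + n - 2 * c * b by rewrite -qc addrK.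
have {qc'}-> : r' = c' ^+ 2 * a + n - 2 * c' * b by rewrite -qc' addrK.
rewrite -subr_gt0.
(* Expansion around [c']: the first term is nonnegative because [c'] does not pass the vertex, and
   the second is positive. *)
have -> : c ^+ 2 * a + n - 2 * c * b - (c' ^+ 2 * a + n - 2 * c' * b) =
    2 * ((c' - c) * (b - c' * a)) + (c' - c) ^+ 2 * a by ring.
by rewrite ltr_wpDl ?mulr_ge0 ?mulr_gt0 ?exprn_gt0 ?subr_gt0 ?subr_ge0// ltW.
Qed.

End fiber.

Lemma measurable_fiber_risk (R : realType) (Pi : probability R R) (m1 m2 : nat)
    (rho : R) (psi : R -> R) : 0 < rho -> measurable_fun setT psi ->
  measurable_fun setT (fun z => fiber_risk Pi m1 m2 rho z (psi z)).
Proof.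
move=> rho0 mpsi.
pose G (x : R * (R * R)) :=
  ((psi x.1 * (x.2.2 / x.2.1) - 1) ^+ 2 * mixture_density m1 m2 rho x)%:E.
have mG : measurable_fun setT G.
  apply/measurable_EFinP/measurable_funM; last exact: measurable_mixture_density.
  apply: measurable_funX; apply: measurable_funB => //; apply: measurable_funM.
    exact: measurableT_comp.
  apply: measurable_funM; first exact: measurableT_comp.
  by apply: (measurableT_comp (@measurable_invr R)); exact: measurableT_comp.
have G0 x : (0 <= G x)%E.
  by rewrite lee_fin mulr_ge0 ?sqr_ge0 ?mixture_density_ge0.
exact: (@measurable_fun_fubini_tonelli_F _ _ _ _ _
  (sigma_finite_prod Pi (@lebesgue_measure R)) G mG G0).
Qed.

(** * From the statistical model to integrals over the ratio *)

Section model.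
Context (R : realType) (d : measure_display) (Omega : measurableType d).
Variables (p q m1 m2 : nat) (Pi : probability R R).
Variables (P : param R p q -> probability Omega R) (tau : {mfun Omega >-> R}).
Variables (X1 : {mfun Omega >-> p.-tuple R}) (S1 : {mfun Omega >-> R}).
Variables (X2 : {mfun Omega >-> q.-tuple R}) (S2 : {mfun Omega >-> R}).
Hypothesis model : mixture_model m1 m2 Pi P tau X1 S1 X2 S2.
Variable par : param R p q.
Hypothesis par_ok : admissible par.
Local Notation rho := (sigma1 par ^+ 2 / sigma2 par ^+ 2).
Local Notation mu := (@lebesgue_measure R).

Lemma scale_law (B1 B2 : set R) : measurable B1 -> measurable B2 ->
  P par (S1 @^-1` B1 `&` S2 @^-1` B2) =
  (\int[Pi]_(t in [set t : R | (0 < t)%R])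
    (scaled_chi2 m1 (sigma1 par ^+ 2 / t)%R B1 *
     scaled_chi2 m2 (sigma2 par ^+ 2 / t)%R B2))%E.
Proof.
move=> mB1 mB2.
have := joint_law model par_ok measurableT measurableT mB1 measurableT mB2.
rewrite !preimage_setT !setTI setIT => ->.
by apply: eq_integral => t _; rewrite !normal_iso_setT mul1e mule1.
Qed.

(** If a Gamma value were 0, division by 0 would make the chi-square density identically 0, and the
    model would give the whole space probability 0 instead of 1. *)
Lemma Gamma_fun_gt0_of_model :
  0 < Gamma_fun (m1%:R / 2 : R) /\ 0 < Gamma_fun (m2%:R / 2 : R).
Proof.
have chi0 m (c : R) : Gamma_fun (m%:R / 2 : R) = 0 -> scaled_chi2 m c setT = 0%E.
  move=> m0; apply: integral0_eq => x _.
  by rewrite /chi2_pdf m0 mulr0 invr0 mulr0 if_same.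
have := scale_law measurableT measurableT.
rewrite !preimage_setT setIT probability_setT => I1.
have pos m : Gamma_fun (m%:R / 2 : R) != 0 -> 0 < Gamma_fun (m%:R / 2 : R).
  by move=> m0; rewrite lt0r m0 Gamma_fun_ge0.
split; apply: pos; apply/eqP => m0; move: I1; rewrite integral0_eq.
- by move/eqP; rewrite onee_eq0.
- by move=> t _; rewrite chi0// mul0e.
- by move/eqP; rewrite onee_eq0.
- by move=> t _; rewrite [X in (_ * X)%E]chi0// mule0.
Qed.

Let s1_gt0 : 0 < sigma1 par. Proof. by case: par_ok. Qed.
Let s2_gt0 : 0 < sigma2 par. Proof. by case: par_ok. Qed.

Lemma rho_gt0 : 0 < rho.
Proof. by rewrite divr_gt0 ?exprn_gt0. Qed.

Lemma rho_le1 : rho <= 1.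
Proof.
have [_ _ s12] := par_ok.
rewrite ler_pdivrMr ?exprn_gt0// mul1r.
by apply: lerXn2r; rewrite ?nnegrE ?(ltW s1_gt0) ?(ltW s2_gt0).
Qed.

Lemma riskE (psi : R -> R) : measurable_fun setT psi ->
  (risk P (scale_estimator psi S1 S2) par =
   \int[mu]_z fiber_risk Pi m1 m2 rho z (psi z))%E.
Proof.
move=> mpsi; rewrite /risk unlock.
pose K (z u : R) := ((psi z * u - 1) ^+ 2)%:E.
have mK : measurable_fun setT (fun x : R * R => K x.1 x.2).
  apply/measurable_EFinP/measurable_funX; apply: measurable_funB => //.
  by apply: measurable_funM => //; exact: measurableT_comp.
have K0 z u : (0 <= K z u)%E by rewrite lee_fin sqr_ge0.
have := mixture_expectation s1_gt0 s2_gt0 scale_law mK K0.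
rewrite /K /L1 /scale_estimator /Z1star => E.
rewrite -[RHS]E; apply: eq_integral => w _.
by rewrite mulrA.
Qed.

(** The ratio has a density under every admissible parameter. Hence an event on the ratio that is
    charged under one parameter has positive Lebesgue measure, a property free of the parameter. *)
Lemma ratio_null (D : set R) : measurable D -> mu D = 0%E ->
  P par [set w | D (S1 w / S2 w)] = 0%E.
Proof.
move=> mD D0.
pose K (z u : R) := (\1_D z : R)%:E.
have mK : measurable_fun setT (fun x : R * R => K x.1 x.2).
  by apply/measurable_EFinP; apply: measurableT_comp => //; exact: measurable_indic.
have K0 z u : (0 <= K z u)%E by rewrite lee_fin.
have := mixture_expectation s1_gt0 s2_gt0 scale_law mK K0.
have mZ : measurable_fun setT (fun w => S1 w / S2 w).
  apply: measurable_funM => //.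
  by apply: (measurableT_comp (@measurable_invr R)).
have mDZ : measurable [set w | D (S1 w / S2 w)].
  by rewrite -[X in measurable X]setTI; exact: mZ.
rewrite (eq_integral (fun w => (\1_[set w | D (S1 w / S2 w)] w)%:E)); last first.
  by move=> w _; rewrite /K !indicE.
rewrite integral_indic// setIT => ->.
pose G (x : R * (R * R)) := ((\1_D x.1)%:E * (mixture_density m1 m2 rho x)%:E)%E.
have mG : measurable_fun setT G.
  apply: emeasurable_funM; apply/measurable_EFinP.
    by apply: measurableT_comp => //; exact: measurable_indic.
  exact: measurable_mixture_density.
have G0 x : (0 <= G x)%E.
  by rewrite mule_ge0 ?lee_fin// mixture_density_ge0// rho_gt0.
have mF := @measurable_fun_fubini_tonelli_F _ _ _ _ _
  (sigma_finite_prod Pi mu) G mG G0.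
have <- := @null_set_integral _ _ _ mu D _ mD (measurable_funTS mF) D0.
rewrite [RHS]integral_mkcond; apply: eq_integral => z _.
rewrite patchE; case: ifPn => // zD; apply: integral0_eq => x _.
by rewrite /K indicE (negbTE zD) mul0e.
Qed.

End model.

Theorem theorem3p1 (R : realType) (d : measure_display)
    (Omega : measurableType d) (p q m1 m2 : nat)
    (p_gt0 : (0 < p)%N) (q_gt0 : (0 < q)%N)
    (m1_gt0 : (0 < m1)%N) (m2_gt0 : (0 < m2)%N)
    (Pi : probability R R) (P : param R p q -> probability Omega R)
    (tau : {mfun Omega >-> R})
    (X1 : {mfun Omega >-> p.-tuple R}) (S1 : {mfun Omega >-> R})
    (X2 : {mfun Omega >-> q.-tuple R}) (S2 : {mfun Omega >-> R})
    (model : mixture_model m1 m2 Pi P tau X1 S1 X2 S2)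
    (moment1_fin : (inv_moment Pi 1 < +oo)%E)
    (moment2_fin : (inv_moment Pi 2 < +oo)%E)
    (psi1 : R -> R)
    (psi1_meas : measurable_fun [set z : R | 0 < z] psi1)
    (psi1_gt0 : forall z : R, 0 < z -> 0 < psi1 z)
    (risk_fin : forall par : param R p q, admissible par ->
       (risk P (scale_estimator psi1 S1 S2) par < +oo)%E)
    (improvable : exists par : param R p q, admissible par /\
       (0 < P par [set w | (psi1 (Z1star S1 S2 w)
                              < psi11Q Pi m1 m2 (Z1star S1 S2 w))%R])%E) :
  uniformly_smaller_risk P
    (scale_estimator (fun z => Num.max (psi1 z) (psi11Q Pi m1 m2 z)) S1 S2)
    (scale_estimator psi1 S1 S2).
Proof.
move=> par par_ok.
have Pi_pos := mixing_support model.
have [Gamma1 Gamma2] := Gamma_fun_gt0_of_model model par_ok.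
rewrite !inv_momentE// in moment1_fin moment2_fin.
pose rho := sigma1 par ^+ 2 / sigma2 par ^+ 2.
have rho0 : 0 < rho := rho_gt0 par_ok.
(* [psi1] is controlled only on positive arguments; its extension by 0 is measurable and nonnegative
   everywhere and gives the same estimators, as the ratio is always positive. *)
pose psi := psi1 \_ [set z : R | 0 < z].
have psiE z : 0 < z -> psi z = psi1 z by move=> z0; rewrite /psi patchE mem_set.
have psi_ge0 z : 0 <= psi z.
  rewrite /psi patchE; case: ifPn => // /set_mem/= z0.
  exact/ltW/psi1_gt0.
have mpsi : measurable_fun setT psi.
  by apply/(measurable_restrictT _ (@measurable_pos R)).
pose psiQ z := Num.max (psi z) (psi11Q Pi m1 m2 z).
have mpsi11 : measurable_fun setT (psi11Q Pi m1 m2).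
  by apply: measurable_funM => //; apply: measurable_funM => //; exact: measurable_funD.
have mpsiQ : measurable_fun setT psiQ by exact: measurable_maxr.
have Z0 w : 0 < S1 w / S2 w by rewrite divr_gt0 ?(S1_gt0 model) ?(S2_gt0 model).
have estE : scale_estimator psi1 S1 S2 = scale_estimator psi S1 S2.
  by apply/funext => w; rewrite /scale_estimator /Z1star psiE.
have estQE : scale_estimator (fun z => Num.max (psi1 z) (psi11Q Pi m1 m2 z)) S1 S2 =
    scale_estimator psiQ S1 S2.
  by apply/funext => w; rewrite /scale_estimator /Z1star /psiQ psiE.
have risk_psi := risk_fin par par_ok.
pose D := [set z : R | 0 < z] `&` [set z | psi z < psi11Q Pi m1 m2 z].
have mD : measurable D.
  apply: measurableI; first exact: measurable_pos.
  rewrite -[X in measurable X]setTI.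
  have := measurable_fun_ltr mpsi mpsi11 => /(_ measurableT [set true]); exact.
(* [improvable] concerns some parameter [par0], possibly different from [par]; the passage through
   Lebesgue measure transfers it. *)
have D_gt0 : (0 < @lebesgue_measure R D)%E.
  have [par0 [par0_ok P0]] := improvable.
  rewrite lt0e measure_ge0 andbT; apply/eqP => D0.
  move: P0; rewrite [X in P par0 X](_ : _ = [set w | D (S1 w / S2 w)]).
    by rewrite (ratio_null model par0_ok mD D0) ltxx.
  apply/seteqP; split => w /=; rewrite /D /Z1star /= -(psiE _ (Z0 w)).
    by move=> lt_psi; split; [exact: Z0|].
  by case.
move: risk_psi; rewrite estE estQE (riskE model par_ok mpsi) (riskE model par_ok mpsiQ).
(* The order restriction enters here: [rho <= 1] gives [z <= z / rho], which keeps [psi11Q] at or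
   below the vertex for [par]. *)
have psi11_le z : 0 < z -> psi11Q Pi m1 m2 z <= (1 + z / rho) / (m1 + m2 + 2)%:R *
    (fine (pos_inv_moment Pi 1) / fine (pos_inv_moment Pi 2)).
  move=> z0; rewrite /psi11Q !inv_momentE//.
  apply: ler_wpM2r; first by rewrite divr_ge0 ?fine_ge0 ?ltW ?pos_inv_moment_gt0.
  apply: ler_wpM2r; first by rewrite invr_ge0.
  rewrite lerD2l ler_pdivlMr//.
  by rewrite ler_piMr ?(ltW z0)//; exact: rho_le1 par_ok.
have lt_risk z : 0 < z -> psi z < psi11Q Pi m1 m2 z ->
    (fiber_risk Pi m1 m2 rho z (psiQ z) < fiber_risk Pi m1 m2 rho z (psi z))%E.
  move=> z0 lt_psi; rewrite /psiQ (max_r (ltW lt_psi)).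
  by apply: fiber_risk_lt => //; exact: psi11_le.
apply: (@lt_ge0_integral _ _ _ (@lebesgue_measure R) D).
- exact: mD.
- exact: measurable_fiber_risk.
- exact: measurable_fiber_risk.
- by move=> z; exact: fiber_risk_ge0.
(* For [z <= 0] both fiber risks are 0; where [psi] is at least [psi11Q], taking the maximum changes
   nothing. *)
- move=> z; have [z0|z0] := leP z 0; first by rewrite !fiber_risk_le0.
  have [le_psi|lt_psi] := leP (psi11Q Pi m1 m2 z) (psi z).
    by rewrite /psiQ (max_l le_psi).
  by rewrite ltW// lt_risk.
- by move=> z; exact: fiber_risk_fin.
- by move=> z [z0 lt_psi]; exact: lt_risk.
- exact: D_gt0.
Qed.
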